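(* Consider the private budget model: one unit of a divisible good and $n$ agents, where agent $i$ has a private nondecreasing valuation function $v_i:[0,1]\to\mathbb{R}_{\ge 0}$ and a private budget $B_i>0$. With the choice $\beta=\frac{3}{10}$, $\gamma=\sqrt{\frac{10}{9}}$ and $\mu=\frac57$, the Random Sampling Auction for Private Budgets (defined in the context) is universally truthful, budget feasible, and for every profile of valuations and budgets its expected liquid welfare (under truthful reports) is at least $\frac1{34}\,OPT$, where $OPT=\max\{\sum_{i}\min\{v_i(x_i),B_i\}: x_i\ge0,\ \sum_i x_i\le1\}$.
   Context: Model. Each agent $i$ reports a valuation function and a budget. The auction outputs an allocation $x_i\ge0$, $\sum_i x_i\le1$, and payments $p_i\ge0$. The utility of agent $i$ is $v_i(x_i)-p_i$ if $p_i\le B_i$ and $-\infty$ if $p_i>B_i$ (true $v_i,B_i$). A deterministic auction is truthful if reporting the true pair $(v_i,B_i)$ is a dominant strategy for every agent. A randomized auction is universally truthful if it is a probability distribution over deterministic truthful auctions. It is budget feasible if always (for every realization) $p_i\le B_i$ for a truth-telling agent $i$. The liquid welfare of an allocation is $\overline W(\mathbf{x})=\sum_i\min\{v_i(x_i),B_i\}$. Throughout, (true and reported) valuations are nondecreasing nonnegative functions on $[0,1]$ for which all maxima below are attained and sets of maximizers have a largest element (this holds for instance if they are upper semicontinuous). When an $\arg\max$ over amounts $x$ is not unique, the largest maximizer is taken. For $Q\subseteq[n]$, $OPT(Q)=\max\{\sum_{i\in Q}\min\{v_i(x_i),B_i\}: x_i\ge0,\ \sum_{i\in Q}x_i\le1\}$.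 A maximum over an empty set of agents is $0$, and $B_i/0=+\infty$. Random Sampling Auction for Private Budgets, with parameters $\gamma>1$, $0<\beta<\frac12$, $0\le\mu\le1$. Initialize $x_i=p_i=0$ and $\bar v_i=\min\{v_i(1),B_i\}$ (from the reports). Then run exactly one of the following: (A) With probability $\frac\mu3$: let $i_1\in\arg\max_i\bar v_i$ and $i_2\in\arg\max_{i\ne i_1}\bar v_i$. If $\bar v_{i_1}\ge\gamma\bar v_{i_2}$, set $x_{i_1}=1$, $p_{i_1}=\gamma\bar v_{i_2}$; otherwise nothing is sold. (B) With probability $\frac{2\mu}3$: put each agent independently with probability $\frac12$ into $S$ or $T$ (a partition of $[n]$). Let $\bar v_T=\max_{i\in T}\bar v_i$. Go through the agents of $S$ in an a priori fixed order; the first agent $i\in S$ with $\bar v_i\ge\bar v_T/\gamma$ gets $x_i=1$ and pays $p_i=\bar v_T/\gamma$, and the auction halts. If there is no such agent nothing is sold. (C) With probability $1-\mu$: put each agent independently with probability $\frac12$ into $S$ or $T$. Set $x_S=x_T=\frac12$. Go through the agents $i\in S$ in an a priori fixed order, setting $$x_i=\arg\max_{0\le x\le\min\{x_S,\,B_i/(\beta OPT(T))\}}\{v_i(x)-\beta\, OPT(T)\,x\},\qquad p_i=\beta\, OPT(T)\,x_i,$$ and then replacing $x_S$ by $x_S-x_i$. Do the same for agents $i\in T$ with $x_T$ in place of $x_S$ and $OPT(S)$ in place of $OPT(T)$.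
   Formalization: Truthfulness is proved for agents whose true valuation satisfies v_i(0)=0; without this it fails (e.g. v_1 constant 10, B_1=10, v_2(x)=x, B_2=1 in part (A)). Other agents' reports, budget feasibility and the welfare bound are not restricted this way. *)

(* Defs.v *)
From HB Require Import structures.
From mathcomp Require Import all_boot all_order all_algebra.
From mathcomp Require Import all_classical all_reals.

Set Implicit Arguments.
Unset Strict Implicit.
Unset Printing Implicit Defensive.

Import Order.TTheory GRing.Theory Num.Theory.

Local Open Scope classical_set_scope.
Local Open Scope ring_scope.

(* Only the restriction of [val] to [0, 1] is ever used. *)
Record agent (R : realType) := Agent { val : R -> R; budget : R }.
Definition profile (R : realType) (n : nat) := 'I_n -> agent R.

Record outcome (R : realType) (n : nat) :=
  Outcome { alloc : 'I_n -> R; pay : 'I_n -> R }.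
Definition auction (R : realType) (n : nat) := profile R n -> outcome R n.

Section Model.
Context {R : realType}.
Implicit Types (t : agent R) (f : R -> R) (a c p x y : R).

Definition largest_maximizer f a x :=
  [/\ 0 <= x <= a,
      forall y, 0 <= y <= a -> f y <= f x
    & forall y, 0 <= y <= a -> f y = f x -> y <= x].

(* An agent only ever faces prices c >= 0 and amounts capped by some
   a <= 1/2, so these are the only maxima required to be attained. *)
Definition admissible_agent t :=
  [/\ 0 < budget t,
      {in `[0, 1] &, {homo val t : x y / x <= y}},
      {in `[0, 1], forall x, 0 <= val t x}
    & forall c a, 0 <= c -> 0 <= a <= 1/2 ->
        exists x, largest_maximizer (fun y => val t y - c * y) a x].

Definition liquid t x := Num.min (val t x) (budget t).

Definition utility t x p : \bar R :=
  if p <= budget t then (val t x - p)%:E else -oo%E.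

Context {n : nat}.
Implicit Types (b : profile R n) (Q S : {set 'I_n}) (z : 'I_n -> R).

Definition feasible Q z :=
  (forall i, i \in Q -> 0 <= z i) /\ \sum_(i in Q) z i <= 1.

Definition liquid_welfare b Q z := \sum_(i in Q) liquid (b i) (z i).

Definition OPT b Q := sup [set liquid_welfare b Q z | z in feasible Q].

Definition OPT_attained b Q :=
  exists2 z, feasible Q z &
    forall z', feasible Q z' -> liquid_welfare b Q z' <= liquid_welfare b Q z.

Definition admissible b :=
  (forall i, admissible_agent (b i)) /\ (forall Q, OPT_attained b Q).

Definition valid_auction (M : auction R n) :=
  forall b, admissible b ->
    feasible [set: 'I_n] (alloc (M b)) /\ forall i, 0 <= pay (M b) i.

(* [t] is the true type of agent i and [b] an arbitrary profile of reports.
   True valuations are normalized by [val t 0 = 0]: otherwise an agent with a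
   constant positive valuation gains by underreporting, since it then loses
   the good in [auctionA], pays nothing and still enjoys [val t 0]. *)
Definition truthful (M : auction R n) :=
  forall b i t, let b' := [eta b with i |-> t] in
    admissible b -> admissible b' -> val t 0 = 0 ->
    (utility t (alloc (M b) i) (pay (M b) i)
       <= utility t (alloc (M b') i) (pay (M b') i))%E.

End Model.

Record randomized_auction (R : realType) (n : nat) := RandomizedAuction {
  seed : finType;
  prob : seed -> R;
  run : seed -> auction R n }.

Section Randomized.
Context {R : realType} {n : nat}.
Implicit Types (M : randomized_auction R n).

Definition universally_truthful M :=
  [/\ forall w : seed M, 0 <= prob w,
      \sum_(w : seed M) prob w = 1
    & forall w : seed M, valid_auction (run w) /\ truthful (run w)].

Definition budget_feasible M :=
  forall (w : seed M) b i, admissible b -> pay (run w b) i <= budget (b i).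

Definition expected_liquid_welfare M (b : profile R n) :=
  \sum_(w : seed M) prob w * liquid_welfare b [set: 'I_n] (alloc (run w b)).

End Randomized.

Section RandomSampling.
Context {R : realType} {n : nat}.
Variables (beta gamma mu : R).
(* [top] selects i_1 (ties broken arbitrarily); [oB] and [oC] are the fixed
   orders in which the agents are visited. *)
Variables (top : profile R n -> 'I_n) (oB oC : seq 'I_n).
Implicit Types (b : profile R n) (S : {set 'I_n}).

Definition vbar b i := liquid (b i) 1.

(* [vbar] is nonnegative on admissible profiles, so the default value 0 only
   matters when the range of the maximum is empty. *)
Definition max_vbar b S := \big[Num.max/0]_(i in S) vbar b i.

Definition no_sale : outcome R n := Outcome (fun=> 0) (fun=> 0).

Definition sell_all (i : 'I_n) (p : R) : outcome R n :=
  Outcome (fun j => if j == i then 1 else 0) (fun j => if j == i then p else 0).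

Definition auctionA : auction R n := fun b =>
  let i1 := top b in
  let v2 := max_vbar b (~: [set i1])%SET in
  if gamma * v2 <= vbar b i1 then sell_all i1 (gamma * v2) else no_sale.

Definition auctionB S : auction R n := fun b =>
  let r := max_vbar b (~: S)%SET / gamma in
  if [seq i <- oB | (i \in S) && (r <= vbar b i)] is i :: _
  then sell_all i r else no_sale.

(* The largest amount available at unit price c when a is left; B / 0 = +oo. *)
Definition cap (t : agent R) (c a : R) :=
  if c == 0 then a else Num.min a (budget t / c).

Definition demand (t : agent R) (c a : R) : R :=
  xget 0 [set x | largest_maximizer (fun y => val t y - c * y) (cap t c a) x].

Fixpoint serve b (c a : R) (s : seq 'I_n) : 'I_n -> R :=
  if s is i :: s' then
    let x := demand (b i) c a in
    fun j => if j == i then x else serve b c (a - x) s' j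
  else fun=> 0.

Definition price b S := beta * OPT b S.

Definition auctionC S : auction R n := fun b =>
  let T := (~: S)%SET in
  let xS := serve b (price b T) (1/2) [seq i <- oC | i \in S] in
  let xT := serve b (price b S) (1/2) [seq i <- oC | i \in T] in
  Outcome (fun i => if i \in S then xS i else xT i)
          (fun i => if i \in S then price b T * xS i else price b S * xT i).

(* The seed records which of the three auctions is run and, for the last two,
   the sampled set: as each agent joins it on an independent fair coin, it is
   uniform among the 2 ^ n sets of agents. *)
Definition rs_seed : finType := (unit + ({set 'I_n} + {set 'I_n}))%type.

Definition rs_prob (w : rs_seed) : R :=
  match w with
  | inl _ => mu / 3
  | inr (inl _) => 2 * mu / 3 * (1/2) ^+ n
  | inr (inr _) => (1 - mu) * (1/2) ^+ n
  end.

Definition rs_run (w : rs_seed) : auction R n :=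
  match w with
  | inl _ => auctionA
  | inr (inl A) => auctionB A
  | inr (inr A) => auctionC A
  end.

Definition random_sampling_auction : randomized_auction R n :=
  RandomizedAuction rs_prob rs_run.

End RandomSampling.

(* Main.v *)
Require Import Defs.
From HB Require Import structures.
From mathcomp Require Import all_boot all_order all_algebra.
From mathcomp Require Import all_classical all_reals.
From mathcomp Require Import ring lra.

Set Implicit Arguments.
Unset Strict Implicit.
Unset Printing Implicit Defensive.

Import Order.TTheory GRing.Theory Num.Theory.

Local Open Scope ring_scope.

(* With O = OPT, let a be the largest vbar, s the share of a global optimum
   that falls in the random set S, and K = 3/10 O a bound on both unit prices.

   On either side of auction C, let r be the amount left over.  If K r < a, the
   revenue alone is at least (3/20 - a/O) times the optimum of the other side.
   If K r >= a, compare with an optimal y for this side: an agent with y_i <= r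
   could afford y_i and loses at most K y_i, and an agent with y_i > r has value
   at most a <= K r < K y_i, so the welfare is at least the optimum of the side
   minus K.  Adding the two sides, the welfare of auction C is at least
     (3/20 O - a) (1 - 35/8 (2 s/O - 1)^2),
   and E (2 s/O - 1)^2 <= a/O since the agents choose their sides by independent
   signs.

   Auctions A and B together contribute at least 3/14 a: either A sells
   to the largest agent, or the second largest value is above a / gamma and B
   collects 9/10 a as soon as S separates these two agents.  The bound
   1/34 O is then a quadratic inequality in a/O. *)

Local Notation val := Defs.val.

(** * Demand of a single agent at a fixed unit price *)

Section Agent.
Context {R : realType}.
Implicit Types (t : agent R) (a c p x y : R).

Lemma liquid_ge0 t x : admissible_agent t -> 0 <= x <= 1 -> 0 <= liquid t x.
Proof.
move=> [B0 _ v0 _] x01; rewrite le_min (ltW B0) andbT.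
by apply: v0; rewrite in_itv.
Qed.

Lemma le_liquid t x y :
  admissible_agent t -> 0 <= x -> x <= y -> y <= 1 -> liquid t x <= liquid t y.
Proof.
move=> [_ vmono _ _] x0 xy y1; rewrite le_min !ge_min lexx orbT andbT.
by apply/orP; left; apply: vmono => //; rewrite in_itv /= ?x0 ?y1 /=; lra.
Qed.

Lemma le_cap t c a y : 0 <= c ->
  (y <= cap t c a) = (y <= a) && ((c == 0) || (c * y <= budget t)).
Proof.
move=> c0; rewrite /cap; case: eqVneq => [//|cN0] /=; first by rewrite andbT.
by rewrite le_min ler_pdivlMr ?lt_def ?cN0 // mulrC.
Qed.

Lemma cap_itv t c a : admissible_agent t -> 0 <= c -> 0 <= a ->
  0 <= cap t c a <= a.
Proof.
move=> [B0 _ _ _] c0 a0; rewrite le_cap // a0 mulr0 ltW // orbT /=.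
by have := lexx (cap t c a); rewrite {1}le_cap // => /andP[].
Qed.

Lemma demandP t c a : admissible_agent t -> 0 <= c -> 0 <= a <= 1/2 ->
  largest_maximizer (fun y => val t y - c * y) (cap t c a) (demand t c a).
Proof.
move=> tadm c0 /andP[a0 a12]; apply: xgetPex.
case: (tadm) => _ _ _; apply=> //.
by have /andP[-> capa] := cap_itv tadm c0 a0; apply: le_trans a12.
Qed.

Lemma demand_itv t c a : admissible_agent t -> 0 <= c -> 0 <= a <= 1/2 ->
  0 <= demand t c a <= a.
Proof.
move=> tadm c0 a012; have [/andP[-> xc] _ _] := demandP tadm c0 a012.
case/andP: a012 => a0 _; have /andP[_] := cap_itv tadm c0 a0.
exact: le_trans.
Qed.

Lemma demand_budget t c a : admissible_agent t -> 0 <= c -> 0 <= a <= 1/2 ->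
  c * demand t c a <= budget t.
Proof.
move=> tadm c0 a012; have [/andP[_ +] _ _] := demandP tadm c0 a012.
rewrite le_cap // => /andP[_ /orP[/eqP->|//]].
by rewrite mul0r; case: tadm => /ltW.
Qed.

Lemma demand_max t c a y :
    admissible_agent t -> 0 <= c -> 0 <= a <= 1/2 ->
    0 <= y <= a -> c * y <= budget t ->
  val t y - c * y <= val t (demand t c a) - c * demand t c a.
Proof.
move=> tadm c0 a012 /andP[y0 ya] cyB.
have [_ + _] := demandP tadm c0 a012; apply.
by rewrite y0 le_cap // ya cyB orbT.
Qed.

(** Buying nothing is affordable, so the net value at the demand is at least [val t 0], which is
    nonnegative; the cap keeps the payment within the budget. *)
Lemma liquid_demand_ge_pay t c a :
    admissible_agent t -> 0 <= c -> 0 <= a <= 1/2 ->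
  c * demand t c a <= liquid t (demand t c a).
Proof.
move=> tadm c0 a012; rewrite le_min demand_budget // andbT.
have [B0 _ v0 _] := tadm; have /andP[a0 _] := a012.
have := @demand_max t c a 0 tadm c0 a012; rewrite lexx a0 mulr0 subr0.
move=> /(_ isT (ltW B0)).
have : 0 <= val t 0 by apply: v0; rewrite in_itv /=; lra.
by lra.
Qed.

(** If [y] is affordable, optimality of the demand bounds its value, and the budget is at least
    [liquid t y] anyway. If [c * y] exceeds the budget, the left-hand side is negative. *)
Lemma liquid_demand_ge t c a y :
    admissible_agent t -> 0 <= c -> 0 <= a <= 1/2 -> 0 <= y <= a ->
  liquid t y - c * y <= liquid t (demand t c a).
Proof.
move=> tadm c0 a012 ya; have [B0 _ _ _] := tadm.
have xB := demand_budget tadm c0 a012.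
have /andP[x0 _] := demand_itv tadm c0 a012.
have L0 := liquid_demand_ge_pay tadm c0 a012.
have /andP[y0 _] := ya.
have cx0 := mulr_ge0 c0 x0; have cy0 := mulr_ge0 c0 y0.
have Lv : liquid t y <= val t y by rewrite ge_min lexx.
have LB : liquid t y <= budget t by rewrite ge_min lexx orbT.
have [cyB|cyB] := lerP (c * y) (budget t); last by lra.
have vx := demand_max tadm c0 a012 ya cyB.
by rewrite [leRHS]/liquid le_min; apply/andP; split; lra.
Qed.

End Agent.

(** * Optimal liquid welfare of a set of agents *)

Section Opt.
Context {R : realType} {n : nat}.
Implicit Types (b : profile R n) (Q S : {set 'I_n}) (z : 'I_n -> R).

Lemma feasible_itv Q z i : feasible Q z -> i \in Q -> 0 <= z i <= 1.
Proof.
move=> [z0 z1] iQ; rewrite z0 //=; apply: le_trans z1.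
rewrite (bigD1 i) //= lerDl; apply: sumr_ge0 => j /andP[jQ _]; exact: z0.
Qed.

Lemma big_subsetID (Q S : {set 'I_n}) (F : 'I_n -> R) : S \subset Q ->
  \sum_(i in Q) F i = \sum_(i in S) F i + \sum_(i in (Q :\: S)%SET) F i.
Proof. by move=> /finset.setIidPr SQ; rewrite (big_setID S) SQ. Qed.

Lemma feasibleS Q S z : S \subset Q -> feasible Q z -> feasible S z.
Proof.
move=> SQ [z0 z1]; split=> [i iS|]; first by apply/z0/(fintype.subsetP SQ).
apply: le_trans z1; rewrite (big_subsetID _ SQ) lerDl.
by apply: sumr_ge0 => i; rewrite inE => /andP[_ /z0].
Qed.

Lemma feasible0 Q : feasible Q (fun=> 0 : R).
Proof. by split=> //; rewrite big1. Qed.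

Lemma OPT_ge b Q z : admissible b -> feasible Q z ->
  liquid_welfare b Q z <= OPT b Q.
Proof.
move=> [_ /(_ Q)[z0 _ z0max]] fz; apply: ub_le_sup; last by exists z.
by exists (liquid_welfare b Q z0) => _ [z' fz' <-]; apply: z0max.
Qed.

Lemma OPT_eq b Q : admissible b ->
  exists2 z, feasible Q z & OPT b Q = liquid_welfare b Q z.
Proof.
move=> badm; have [_ /(_ Q)[z fz zmax]] := badm; exists z => //.
apply/le_anti; rewrite OPT_ge // andbT; apply: ge_sup.
  by exists (liquid_welfare b Q z), z.
by move=> _ [z' fz' <-]; apply: zmax.
Qed.

Lemma liquid_welfare_ge0 b Q z : admissible b ->
  (forall i, i \in Q -> 0 <= z i <= 1) -> 0 <= liquid_welfare b Q z.
Proof. by move=> [adm _] z01; apply: sumr_ge0 => i /z01; apply: liquid_ge0. Qed.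

Lemma OPT_ge0 b Q : admissible b -> 0 <= OPT b Q.
Proof.
move=> badm; apply: le_trans (OPT_ge badm (feasible0 Q)).
by apply: liquid_welfare_ge0 => // i _; rewrite lexx ler01.
Qed.

(** An optimal allocation for [S] is extended by zero; the agents of [Q] outside [S] then add their
    liquid value at 0, which is nonnegative but may be positive. *)
Lemma OPT_le b Q S : admissible b -> S \subset Q -> OPT b S <= OPT b Q.
Proof.
move=> badm SQ; have [z fz ->] := OPT_eq S badm.
pose z' i := if i \in S then z i else 0.
have eqS (F : 'I_n -> R -> R) : \sum_(i in Q) F i (z' i) =
    \sum_(i in S) F i (z i) + \sum_(i in (Q :\: S)%SET) F i 0.
  rewrite (big_subsetID _ SQ); congr (_ + _); apply: eq_bigr => i.
    by rewrite /z' => ->.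
  by rewrite /z' inE => /andP[/negbTE->].
have fz' : feasible Q z'.
  split=> [i _|]; first by rewrite /z'; case: ifP => // /(fz.1).
  by rewrite (eqS (fun _ x => x)) [X in _ + X]big1 ?addr0 ?fz.2.
apply: le_trans (OPT_ge badm fz').
rewrite /liquid_welfare (eqS (fun i => liquid (b i))) lerDl.
by apply: sumr_ge0 => i _; apply: liquid_ge0; [case: badm|rewrite lexx ler01].
Qed.

Lemma eq_OPT b b' Q : (forall i, i \in Q -> b i = b' i) -> OPT b Q = OPT b' Q.
Proof.
move=> eqb; rewrite /OPT; congr sup; apply/seteqP; split=> _ [z fz <-];
  by exists z => //; apply: eq_bigr => i iQ; rewrite eqb.
Qed.

End Opt.

(** * Sequential sale of half the good at a fixed unit price *)

Section Serve.
Context {R : realType} {n : nat}.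
Implicit Types (b : profile R n) (S : {set 'I_n}) (a c : R) (s : seq 'I_n).

Lemma serve_notin b c a s i : i \notin s -> serve b c a s i = 0.
Proof.
elim: s a => [//|j s IHs] a; rewrite inE negb_or => /andP[/negbTE /= -> /IHs].
exact.
Qed.

Lemma serve_cons b c a i s : uniq (i :: s) ->
  \sum_(j <- i :: s) serve b c a (i :: s) j
    = demand (b i) c a + \sum_(j <- s) serve b c (a - demand (b i) c a) s j.
Proof.
move=> /andP[/= iNs _]; rewrite big_cons eqxx; congr (_ + _).
apply: eq_big_seq => j js; case: eqP => // ji; move: iNs; by rewrite -ji js.
Qed.

Lemma serve_sum b c a s :
    (forall i, admissible_agent (b i)) -> 0 <= c -> 0 <= a <= 1/2 -> uniq s ->
  0 <= \sum_(i <- s) serve b c a s i <= a.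
Proof.
move=> adm c0; elim: s a => [|i s IHs] a a012 us.
  by rewrite big_nil lexx; case/andP: a012.
have /andP[x0 xa] := demand_itv (adm i) c0 a012.
have := IHs (a - demand (b i) c a); rewrite serve_cons //.
case/andP: us => _ us; have -> : 0 <= a - demand (b i) c a <= 1/2.
  by case/andP: a012 => *; apply/andP; split; lra.
by move=> /(_ isT us); lra.
Qed.

(* The amount a' left when agent i is reached depends on the reports of the
   agents before i only, and is at least what is left at the end. *)
Lemma serve_demand b c a s i :
    (forall j, admissible_agent (b j)) -> 0 <= c -> 0 <= a <= 1/2 ->
    uniq s -> i \in s ->
  exists2 a', a - \sum_(j <- s) serve b c a s j <= a' <= a /\ 0 <= a' &
    forall b', (forall j, j != i -> b' j = b j) ->
      serve b' c a s i = demand (b' i) c a'.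
Proof.
move=> adm c0; elim: s a => [//|j s IHs] a a012 us.
have /andP[xj0 xja] := demand_itv (adm j) c0 a012.
have /andP[sum0 suma] := serve_sum adm c0 a012 us.
have [a0 a12] := andP a012.
rewrite inE; have [->|ij] := eqVneq i j => [_|/= is_].
  exists a => [|b' _]; last by rewrite /= eqxx.
  by split=> //; apply/andP; split; lra.
move: sum0 suma; rewrite serve_cons // => sum0 suma.
case: (IHs (a - demand (b j) c a)) => // [||a' [/andP[a'1 a'2] a'0] eqa'].
- by apply/andP; split; lra.
- by case/andP: us.
exists a' => [|b' eqb]; first by split=> //; apply/andP; split; lra.
by rewrite /= (negbTE ij) eqb 1?eq_sym // eqa'.
Qed.

Lemma serve_itv b c a s i :
    (forall j, admissible_agent (b j)) -> 0 <= c -> 0 <= a <= 1/2 -> uniq s ->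
  0 <= serve b c a s i <= a /\ c * serve b c a s i <= budget (b i).
Proof.
move=> adm c0 a012 us; have [is_|iNs] := boolP (i \in s); last first.
  rewrite serve_notin // mulr0 lexx; case/andP: a012 => -> _; split=> //.
  by have [/ltW] := adm i.
have [a' [/andP[_ a'a] a'0] /(_ b)->//] := serve_demand adm c0 a012 us is_.
have a'12 : 0 <= a' <= 1/2 by case/andP: a012 => *; apply/andP; split; lra.
have /andP[x0 xa'] := demand_itv (adm i) c0 a'12.
by split; [apply/andP; split; lra|exact: demand_budget].
Qed.

Variables (b : profile R n) (oC : seq 'I_n).
Hypotheses (badm : admissible b) (hoC : perm_eq oC (enum 'I_n)).

Lemma big_order S (F : 'I_n -> R) :
  \sum_(i <- [seq i <- oC | i \in S]) F i = \sum_(i in S) F i.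
Proof. by rewrite big_filter (perm_big _ hoC) big_enum_cond. Qed.

Lemma uniq_order S : uniq [seq i <- oC | i \in S].
Proof. by rewrite filter_uniq // (perm_uniq hoC) enum_uniq. Qed.

Lemma mem_order S i : (i \in [seq i <- oC | i \in S]) = (i \in S).
Proof. by rewrite mem_filter (perm_mem hoC) mem_enum andbT. Qed.

Local Notation served S c := (serve b c (1/2) [seq i <- oC | i \in S]).

(* Let r be the amount left over, and compare with an optimal y for S.
   An agent with y_i <= r could have bought y_i, so gets at least its value
   minus c * y_i; the value of an agent with y_i > r is at most
   w <= K * r < K * y_i.  The losses add up to at most K. *)
Lemma serve_welfare S c K w :
    0 <= c -> c <= K -> (forall i, vbar b i <= w) ->
  OPT b S - K <= liquid_welfare b S (served S c) \/
  c * (K / 2 - w) <= K * liquid_welfare b S (served S c).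
Proof.
move=> c0 cK hw; have adm := badm.1.
have a012 : 0 <= (1/2 : R) <= 1/2 by apply/andP; split; lra.
have us := uniq_order S.
have /andP[sum0 sum1] := serve_sum adm c0 a012 us.
have xdem i : i \in S -> exists2 a', 1/2 - \sum_(j in S) served S c j <= a'
    /\ 0 <= a' <= 1/2 & served S c i = demand (b i) c a'.
  move=> iS; have := serve_demand adm c0 a012 us _.
  rewrite -big_order => /(_ i); rewrite mem_order => /(_ iS).
  move=> [a' [/andP[? ?] ?] /(_ b)/(_ (fun _ _ => erefl))?]; exists a' => //.
  by split=> //; apply/andP.
move: sum0 sum1; rewrite big_order.
set A := \sum_(i in S) served S c i => A0 A12.
have revenue : c * A <= liquid_welfare b S (served S c).
  rewrite mulr_sumr; apply: ler_sum => i /xdem[a' [_ a'12] ->].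
  exact: liquid_demand_ge_pay.
have [Kr|Kr] := lerP w (K * (1/2 - A)); [left|right]; last first.
  (* Here [K * (1/2 - A) < w], that is [K / 2 - w < K * A]: much has been sold, and the revenue
     [c * A] alone gives the second alternative. *)
  have cw : c * w >= c * (K * (1/2 - A)) by apply: ler_wpM2l => //; exact: ltW.
  have := ler_wpM2l (le_trans c0 cK) revenue.
  by move: cw; nra.
have [y [y0 y1] ->] := OPT_eq S badm.
have yitv i : i \in S -> 0 <= y i <= 1 by apply: feasible_itv.
have K0 := le_trans c0 cK.
have : \sum_(i in S) (liquid (b i) (y i) - K * y i)
         <= liquid_welfare b S (served S c).
  apply: ler_sum => i iS; have [a' [ra' a'12] xE] := xdem i iS.
  have /andP[yi0 yi1] := yitv i iS.
  have [yr|yr] := lerP (y i) (1/2 - A).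
    have /andP[a'0 _] := a'12.
    have ya' : 0 <= y i <= a' by rewrite yi0 /=; apply: le_trans ra'.
    rewrite xE; apply: le_trans (liquid_demand_ge (adm i) c0 a'12 ya').
    by rewrite lerD2l lerN2 ler_wpM2r.
  have Ly : liquid (b i) (y i) <= w.
    by apply: le_trans (hw i); apply: le_liquid.
  have Ky : K * (1/2 - A) <= K * y i by rewrite ler_wpM2l // ltW.
  have L0 : 0 <= liquid (b i) (served S c i).
    apply: liquid_ge0 => //; rewrite xE.
    by have /andP[-> ?] := demand_itv (adm i) c0 a'12; lra.
  by lra.
rewrite sumrB -mulr_sumr; apply: le_trans; rewrite lerD2l lerN2.
by rewrite -[leRHS]mulr1 ler_wpM2l.
Qed.

End Serve.

(** * Utility of an agent offered the whole good *)

Section TakeItOrLeaveIt.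
Context {R : realType}.
Implicit Types (t : agent R) (p : R).

Lemma utility_no_sale t : 0 < budget t -> val t 0 = 0 -> utility t 0 0 = 0%E.
Proof. by move=> /ltW B0 t0; rewrite /utility B0 t0 subr0. Qed.

Lemma utility_accept t p : p <= liquid t 1 -> (0 <= utility t 1 p)%E.
Proof. by rewrite le_min /utility => /andP[pv ->]; rewrite lee_fin subr_ge0. Qed.

(** A price above [liquid t 1] exceeds the budget, giving utility [-oo], or the value. The second
    disjunct serves the price 0 in auction A, where the first may fail. *)
Lemma utility_reject t p :
  (liquid t 1 < p) || (val t 1 <= p) -> (utility t 1 p <= 0)%E.
Proof.
rewrite /utility gt_min => h; case: ifP => [pB|_]; last exact: leNye.
rewrite lee_fin subr_le0; case/orP: h => // /orP[/ltW//|].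
by rewrite ltNge pB.
Qed.

End TakeItOrLeaveIt.

(** * Validity, truthfulness and budget feasibility of the three auctions *)

Section Truthful.
Context {R : realType} {n : nat}.
Implicit Types (b : profile R n) (S : {set 'I_n}) (beta gamma : R).

Lemma max_vbar_ge0 b S : 0 <= max_vbar b S.
Proof. exact: bigmax_ge_id. Qed.

Lemma le_max_vbar b S i : i \in S -> vbar b i <= max_vbar b S.
Proof. by move=> iS; apply: le_bigmax_cond. Qed.

Lemma eq_max_vbar b b' S :
  (forall i, i \in S -> b i = b' i) -> max_vbar b S = max_vbar b' S.
Proof. by move=> eqb; apply: eq_bigr => i iS; rewrite /vbar eqb. Qed.

Lemma feasible_sell_all (i : 'I_n) (p : R) :
  feasible [set: 'I_n] (alloc (sell_all i p)).
Proof.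
split=> [j _|] /=; first by case: ifP.
by rewrite (bigD1 i) ?inE //= eqxx big1 ?addr0 // => j /andP[_ /negbTE->].
Qed.

Lemma valid_auctionA gamma (top : profile R n -> 'I_n) :
  0 <= gamma -> valid_auction (auctionA gamma top).
Proof.
move=> g0 b badm; rewrite /auctionA; case: ifP => _ /=; last first.
  by split=> //; apply: feasible0.
split; first exact: feasible_sell_all.
by move=> i; case: ifP => // _; rewrite mulr_ge0 // max_vbar_ge0.
Qed.

(** The price [gamma * v2] offered to agent [i] depends on the other reports only, and the truth
    never gives negative utility. So only a winning misreport matters: either the truth wins too, at
    the same price, or the price is one to reject. The factor [gamma > 1] makes this independent of
    how [top] breaks ties. *)
Lemma truthful_auctionA gamma (top : profile R n -> 'I_n) :
    (forall b i, vbar b i <= vbar b (top b)) -> 1 < gamma ->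
  truthful (auctionA gamma top).
Proof.
move=> htop g1 b i t b' badm b'adm t0.
have b'i : b' i = t by rewrite /b' /= eqxx.
have [B0 _ _ _] : admissible_agent t by rewrite -b'i; case: b'adm.
have loss := utility_no_sale B0 t0.
set v2 := max_vbar b (~: [set i])%SET.
have v2E : max_vbar b' (~: [set i])%SET = v2.
  by apply: eq_max_vbar => j; rewrite !inE /b' /= => /negbTE->.
have v20 : 0 <= v2 := max_vbar_ge0 _ _.
have vE : vbar b' i = liquid t 1 by rewrite /vbar b'i.
have ge0 : (0 <= utility t (alloc (auctionA gamma top b') i)
                           (pay (auctionA gamma top b') i))%E.
  rewrite /auctionA; case: ifP => c /=; last by rewrite loss.
  case: eqP c => [<-|_ _]; last by rewrite loss.
  by rewrite vE => /utility_accept.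
rewrite {1 2}/auctionA; case: ifP => c /=; last by rewrite loss.
case: eqP c => [ti c|_ _]; last by rewrite loss.
move: c; rewrite -ti -/v2 => c.
have [ti'|ti'] := eqVneq (top b') i; last first.
  apply: le_trans ge0; apply: utility_reject.
  have : liquid t 1 <= v2.
    rewrite -vE; apply: le_trans (htop _ _) _; rewrite -v2E.
    by apply: le_max_vbar; rewrite !inE.
  (* For [v2 = 0] the factor [gamma] gives no strict inequality; since the budget is positive, the
     value itself is then at most 0. *)
  move: v20; rewrite le_eqVlt => /orP[/eqP<-|v2_gt0] lv2.
    rewrite mulr0 orbC; move: lv2; rewrite ge_min [budget t <= 0]leNgt B0 orbF.
    by move->.
  by rewrite (le_lt_trans lv2) // ltr_pMl.
have [c'|c'] := lerP (gamma * v2) (liquid t 1).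
  by rewrite /auctionA ti' v2E vE c' /= eqxx.
by apply: le_trans ge0; apply: utility_reject; rewrite c'.
Qed.

Lemma budget_auctionA gamma (top : profile R n -> 'I_n) b i :
  admissible b -> pay (auctionA gamma top b) i <= budget (b i).
Proof.
move=> [adm _]; have [/ltW B0 _ _ _] := adm i.
rewrite /auctionA; case: ifP => //= c; case: eqP => // ->.
by apply: le_trans c _; rewrite ge_min lexx orbT.
Qed.

Lemma valid_auctionB gamma (oB : seq 'I_n) S :
  0 <= gamma -> valid_auction (auctionB gamma oB S : auction R n).
Proof.
move=> g0 b badm; rewrite /auctionB /=; case: (seq.filter _ _) => [|i _] /=.
  by split=> //; apply: feasible0.
split; first exact: feasible_sell_all.
by move=> j; case: ifP => // _; rewrite divr_ge0 // max_vbar_ge0.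
Qed.

Lemma auctionB_outcome gamma (oB : seq 'I_n) S b i :
  let r := max_vbar b (~: S)%SET / gamma in
  let wins := ohead [seq j <- oB | (j \in S) && (r <= vbar b j)] == Some i in
  (alloc (auctionB gamma oB S b) i = if wins then 1 else 0) *
  (pay (auctionB gamma oB S b) i = if wins then r else 0).
Proof.
rewrite /auctionB /=; case: (seq.filter _ _) => [//|j s] /=.
by rewrite (inj_eq Some_inj) eq_sym.
Qed.

Lemma ohead_filter (a : pred 'I_n) (s : seq 'I_n) i :
  ohead [seq j <- s | a j] = Some i -> a i.
Proof.
elim: s => [//|j s IHs] /=; case: ifP => [aj /= [<-]//|_]; exact: IHs.
Qed.

(** The price comes from the complement of [S], so no agent of [S] influences it, and the others
    never win. If both reports of [i] accept it, the lists of accepting agents coincide, hence so do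
    the outcomes for [i]; if only the misreport does, the price exceeds the true liquid value. *)
Lemma truthful_auctionB gamma (oB : seq 'I_n) S :
  truthful (auctionB gamma oB S : auction R n).
Proof.
move=> b i t b' badm b'adm t0.
have b'i : b' i = t by rewrite /b' /= eqxx.
have [B0 _ _ _] : admissible_agent t by rewrite -b'i; case: b'adm.
have loss := utility_no_sale B0 t0.
rewrite !auctionB_outcome.
set p := max_vbar b _ / gamma; set p' := max_vbar b' _ / gamma.
set a := fun j => (j \in S) && (p <= vbar b j).
set a' := fun j => (j \in S) && (p' <= vbar b' j).
have wins_a := @ohead_filter a oB i; have wins_a' := @ohead_filter a' oB i.
have [iS|iNS] := boolP (i \in S); last first.
  case: eqP => [/wins_a|_]; first by rewrite /a (negbTE iNS).
  case: eqP => [/wins_a'|_]; first by rewrite /a' (negbTE iNS).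
  by rewrite lexx.
have pp' : p' = p.
  congr (_ / _); apply: eq_max_vbar => j; rewrite inE /b' /=; case: eqP => // ->.
  by rewrite iS.
have vE : vbar b' i = liquid t 1 by rewrite /vbar b'i.
have ge0 : (0 <= utility t
    (if ohead [seq j <- oB | a' j] == Some i then 1 else 0)%R
    (if ohead [seq j <- oB | a' j] == Some i then p' else 0)%R)%E.
  case: eqP => [/wins_a'/andP[_]|_]; last by rewrite loss.
  by rewrite vE; exact: utility_accept.
have [ai|aNi] := boolP (a i); last first.
  by case: eqP => [/wins_a|_]; [rewrite (negbTE aNi)|rewrite loss].
have [a'i|a'Ni] := boolP (a' i); last first.
  apply: le_trans ge0; case: eqP => [_|_]; last by rewrite loss.
  apply: utility_reject; rewrite ltNge -vE -pp'.
  by move: a'Ni; rewrite /a' iS /= => ->.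
suff -> : [seq j <- oB | a' j] = [seq j <- oB | a j] by rewrite pp' lexx.
apply: eq_filter => j; have [->|ji] := eqVneq j i; first by rewrite ai a'i.
by rewrite /a /a' pp' /vbar /b' /= (negbTE ji).
Qed.

Lemma budget_auctionB gamma (oB : seq 'I_n) S b i :
  admissible b -> pay (auctionB gamma oB S b) i <= budget (b i).
Proof.
move=> [adm _]; have [/ltW B0 _ _ _] := adm i.
rewrite auctionB_outcome.
case: eqP => // /ohead_filter /andP[_ /le_trans]; apply.
by rewrite ge_min lexx orbT.
Qed.

Variable oC : seq 'I_n.
Hypothesis hoC : perm_eq oC (enum 'I_n).

Lemma price_ge0 beta b S : 0 <= beta -> admissible b -> 0 <= price beta b S.
Proof. by move=> beta0 badm; rewrite mulr_ge0 // OPT_ge0. Qed.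

Lemma half_itv : 0 <= (1/2 : R) <= 1/2.
Proof. by apply/andP; split; lra. Qed.

Lemma auctionC_itv beta S b i : 0 <= beta -> admissible b ->
  0 <= alloc (auctionC beta oC S b) i <= 1/2 /\
  0 <= pay (auctionC beta oC S b) i <= budget (b i).
Proof.
move=> beta0 badm; have adm := badm.1 => /=.
have h := fun T S => serve_itv i adm (price_ge0 T beta0 badm) half_itv
                       (uniq_order hoC S).
have hx := fun T S => (h T S).1; have hp := fun T S => (h T S).2.
case: ifP => iS; rewrite hx hp andbT mulr_ge0 ?price_ge0 //.
  by have /andP[] := hx (~: S)%SET S.
by have /andP[] := hx S (~: S)%SET.
Qed.

Lemma valid_auctionC beta S :
  0 <= beta -> valid_auction (auctionC beta oC S : auction R n).
Proof.
move=> beta0 b badm; split; last first.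
  by move=> i; have [_ /andP[]] := auctionC_itv S i beta0 badm.
split=> [i _|]; first by have [/andP[]] := auctionC_itv S i beta0 badm.
have h := fun T S => serve_sum badm.1 (price_ge0 T beta0 badm) half_itv
                       (uniq_order hoC S).
have /andP[_ hS] := h (~: S)%SET S; have /andP[_ hT] := h S (~: S)%SET.
rewrite !(big_order hoC) in hS hT.
rewrite (big_setID S) /= finset.setTI finset.setTD.
under eq_bigr => i iS do rewrite iS.
under [X in _ + X]eq_bigr => i do rewrite inE => /negbTE->.
lra.
Qed.

Lemma utility_demand_max (t : agent R) c a x :
    admissible_agent t -> 0 <= c -> 0 <= a <= 1/2 -> 0 <= x <= a ->
  (utility t x (c * x) <= utility t (demand t c a) (c * demand t c a))%E.
Proof.
move=> tadm c0 a012 xa; rewrite /utility demand_budget //.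
case: ifP => [cxB|_]; last exact: leNye.
by rewrite lee_fin demand_max.
Qed.

(** The unit price is set by the other side and the amount left by the agents served earlier.
    Neither depends on the report of [i], so the truth buys the best affordable amount. *)
Lemma truthful_auctionC beta S :
  0 <= beta -> truthful (auctionC beta oC S : auction R n).
Proof.
move=> beta0 b i t b' badm b'adm t0.
have b'i : b' i = t by rewrite /b' /= eqxx.
have tadm : admissible_agent t by rewrite -b'i; case: b'adm.
have main (T Q : {set 'I_n}) : i \in Q -> i \notin T ->
    let x b := serve b (price beta b T) (1/2) [seq i <- oC | i \in Q] i in
  (utility t (x b) (price beta b T * x b)
     <= utility t (x b') (price beta b' T * x b'))%E.
  move=> iQ iNT /=.
  have -> : price beta b' T = price beta b T.
    congr (_ * _); apply: eq_OPT => j jT; rewrite /b' /=.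
    by case: eqP => // ji; move: iNT; rewrite -ji jT.
  have c0 := price_ge0 T beta0 badm.
  have iQ' : i \in [seq i <- oC | i \in Q] by rewrite mem_order.
  have [a' [/andP[_ a'12] a'0] xE] :=
    serve_demand badm.1 c0 half_itv (uniq_order hoC Q) iQ'.
  have a'012 : 0 <= a' <= 1/2 by rewrite a'0.
  rewrite (xE b) // (xE b') ?b'i => [|j ji]; last by rewrite /b' /= (negbTE ji).
  by apply: utility_demand_max => //; apply: demand_itv => //; apply: badm.1.
rewrite /auctionC /=; case: ifP => iS; apply: main; by rewrite ?inE iS.
Qed.

End Truthful.

(** * Second moments of random signs *)

Section RandomSigns.
Context {R : realType} {n : nat}.
Implicit Types (S : {set 'I_n}) (i j : 'I_n) (w : 'I_n -> R).

(** For uniform [S] these are independent fair signs. *)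
Definition side S i : R := if i \in S then 1 else -1.

Definition toggle i S : {set 'I_n} :=
  if i \in S then (S :\ i)%SET else (i |: S)%SET.

Lemma sumr_const_set (x : R) : \sum_(S : {set 'I_n}) x = x * 2 ^+ n.
Proof.
rewrite sumr_const -cardsT -powersetT card_powerset cardsT card_ord.
by rewrite -natrX mulr_natr.
Qed.

Lemma toggleK i : involutive (toggle i).
Proof.
move=> S; rewrite /toggle; have [iS|iNS] := boolP (i \in S).
  by rewrite !inE eqxx finset.setD1K.
by rewrite !inE eqxx finset.setU1K.
Qed.

Lemma side_toggle i S j :
  side (toggle i S) j = if j == i then - side S j else side S j.
Proof.
rewrite {1}/side; have -> : (j \in toggle i S) = (j \in S) (+) (j == i).
  rewrite /toggle; case: eqVneq => [->|ji]; case: ifP => iS;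
    by rewrite !inE ?eqxx ?(negbTE ji) ?addbF ?iS.
by rewrite /side; case: (j == i); case: (j \in S); rewrite ?opprK.
Qed.

(** For distinct agents, toggling [i] is a bijection on sets that negates the summand, so the sum
    equals its own opposite. *)
Lemma sum_side i j :
  \sum_(S : {set 'I_n}) side S i * side S j = if i == j then 2 ^+ n else 0.
Proof.
have [<-|ij] := eqVneq i j.
  rewrite (eq_bigr (fun=> 1)) => [|S _]; last first.
    by rewrite /side; case: ifP; rewrite ?mulrNN mulr1.
  by rewrite sumr_const_set mul1r.
set X := LHS; suff : X = - X by move=> ?; lra.
rewrite {1}/X (reindex_inj (inv_inj (toggleK i))) /= /X -sumrN.
apply: eq_bigr => S _; rewrite !side_toggle eqxx [j == i]eq_sym (negbTE ij).
by rewrite mulNr.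
Qed.

Lemma sum_side_sqr w :
  \sum_(S : {set 'I_n}) (\sum_i side S i * w i) ^+ 2
    = 2 ^+ n * \sum_i w i ^+ 2.
Proof.
have pair i j : \sum_(S : {set 'I_n}) side S i * w i * (side S j * w j)
    = (if i == j then 2 ^+ n else 0) * (w i * w j).
  by rewrite -sum_side mulr_suml; apply: eq_bigr => S _; ring.
under eq_bigr => S _ do rewrite expr2 big_distrlr /=.
rewrite exchange_big mulr_sumr; apply: eq_bigr => i _ /=.
rewrite exchange_big /=; under eq_bigr do rewrite pair.
rewrite (bigD1 i) //= eqxx expr2 big1 ?addr0 // => j ji.
by rewrite eq_sym (negbTE ji) mul0r.
Qed.

Lemma sum_sideE w S :
  \sum_i side S i * w i = 2 * \sum_(i in S) w i - \sum_i w i.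
Proof.
rewrite [X in _ - X](bigID (mem S)) [LHS](bigID (mem S)) /=.
rewrite (eq_bigr w) => [|i iS]; last by rewrite /side iS mul1r.
rewrite [X in _ + X](eq_bigr (fun i => - w i)) => [|i /negbTE iS]; last first.
  by rewrite /side iS mulN1r.
by rewrite sumrN; ring.
Qed.

End RandomSigns.

(** * The real inequality combining the two sides of auction C *)

Section Welfare.
Context {R : realType}.

(* The optimum is normalized to 1: u and v are the optima of the two sides,
   s and 1 - s their shares of a global optimum, and d stands for 3/20 minus
   the largest value of an agent. *)
Lemma two_sides_welfare (d s u v p q : R) :
    0 <= d <= 3/20 -> s <= u <= 1 -> 1 - s <= v <= 1 -> 0 <= p -> 0 <= q ->
    u - 3/10 <= p \/ v * d <= p -> v - 3/10 <= q \/ u * d <= q ->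
  d * (1 - 35/8 * (2 * s - 1) ^+ 2) <= p + q.
Proof.
(* The case where a side with optimum at most 9/20 satisfies the first alternative. Above the
   threshold 9/20 that alternative alone yields 9/20 - 3/10 = 3/20, which is at least [d]. *)
have smaller (d' s' u' v' p' q' : R) :
    0 <= d' <= 3/20 -> s' <= u' -> u' <= 9/20 ->
    1 - s' <= v' <= 1 -> 0 <= p' -> u' - 3/10 <= p' ->
    v' - 3/10 <= q' \/ u' * d' <= q' ->
  d' * (1 - 35/8 * (2 * s' - 1) ^+ 2) <= p' + q'.
  move=> /andP[d0 d1] su u1 /andP[sv v1] p0 up hq.
  (* Since [v'] is at least 11/20, the first alternative for [q'] gives 1/4, more than [u' * d'] can
     be. *)
  have uq : u' * d' <= q' by case: hq => // hq; nra.
  have sq : s' * d' <= u' * d' by rewrite ler_wpM2r.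
  (* The constant 35/8 makes [s' - 1 + 35/8 * (2 * s' - 1) ^+ 2] vanish at 3/10, with cofactor
     [45/4 - 35/2 * s']. Below 3/10 the bound on [q'] suffices; above it, [p'] adds [s' - 3/10], and
     the cofactor is at most 6, so [d'] times it stays below 1. *)
  rewrite -subr_ge0; have [s3|s3] := lerP s' (3/10).
    have : 0 <= d' * ((3/10 - s') * (45/4 - 35/2 * s')).
      by rewrite mulr_ge0 // mulr_ge0 //; lra.
    by nra.
  have : 0 <= (s' - 3/10) * (1 - d' * (45/4 - 35/2 * s')).
    by rewrite mulr_ge0 //; nra.
  by nra.
move=> d01 /andP[su u1] /andP[sv v1] p0 q0 hp hq; have [d0 d1] := andP d01.
have le_d : d * (1 - 35/8 * (2 * s - 1) ^+ 2) <= d.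
  by rewrite -[leRHS]mulr1 ler_wpM2l // gerBl mulr_ge0 ?sqr_ge0 //; lra.
case: hp hq => [up|up] [vq|vq].
- have [u9|u9] := lerP u (9/20).
    by apply: (smaller d s u v); rewrite ?sv //; left.
  have [v9|v9] := lerP v (9/20); last by lra.
  rewrite [p + q]addrC.
  rewrite (_ : (2 * s - 1) ^+ 2 = (2 * (1 - s) - 1) ^+ 2); last by ring.
  apply: (smaller d (1 - s) v u) => //; last by left.
  by rewrite u1 opprB addrC subrK su.
- have [u9|u9] := lerP u (9/20).
    by apply: (smaller d s u v); rewrite ?sv //; right.
  by lra.
- have [v9|v9] := lerP v (9/20); last by lra.
  rewrite [p + q]addrC.
  rewrite (_ : (2 * s - 1) ^+ 2 = (2 * (1 - s) - 1) ^+ 2); last by ring.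
  apply: (smaller d (1 - s) v u) => //; last by right.
  by rewrite u1 opprB addrC subrK su.
(* Both sides rely on revenue: the bounds add up to [d * (u + v)], and the two optima sum to at
   least 1. *)
- have : d * 1 <= d * (u + v) by rewrite ler_wpM2l //; lra.
  by lra.
Qed.

End Welfare.

(** * Welfare of the three auctions on a fixed admissible profile *)

Section RandomSampling.
Context {R : realType} {n : nat}.
Implicit Types (Q S T : {set 'I_n}).
Variables (b : profile R n).
Hypothesis badm : admissible b.

Local Notation W o := (liquid_welfare b [set: 'I_n] (alloc o)).
Local Notation O := (OPT b [set: 'I_n]).

Lemma vbar_ge0 i : 0 <= vbar b i.
Proof. by apply: liquid_ge0; rewrite ?ler01 ?lexx //; apply: badm.1. Qed.

Lemma valid_welfare_ge0 (M : auction R n) : valid_auction M -> 0 <= W (M b).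
Proof.
move=> /(_ b badm)[fM _]; apply: liquid_welfare_ge0 => // i.
exact: feasible_itv.
Qed.

Lemma vbar_le_welfare i p : vbar b i <= W (sell_all i p).
Proof.
rewrite /liquid_welfare (bigD1 i) ?inE //= eqxx lerDl.
apply: sumr_ge0 => j /andP[_ /negbTE->].
by apply: liquid_ge0; rewrite ?lexx ?ler01 //; apply: badm.1.
Qed.

(** * Contribution of auctions A and B *)

Section LargeAgents.
Variables (gamma : R) (top : profile R n -> 'I_n) (oB : seq 'I_n).
Hypotheses (htop : forall b i, vbar b i <= vbar b (top b)).
Hypotheses (hoB : perm_eq oB (enum 'I_n)).
Hypotheses (gamma0 : 0 < gamma) (gamma2 : gamma ^+ 2 = 10/9).

Local Notation a := (vbar b (top b)).

(** Agent [i] only ensures that someone accepts; the actual buyer may be another agent, but it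
    accepts the same price. *)
Lemma auctionB_welfare S i : i \in S ->
  max_vbar b (~: S)%SET / gamma <= vbar b i ->
  max_vbar b (~: S)%SET / gamma <= W (auctionB gamma oB S b).
Proof.
move=> iS ri; rewrite /auctionB /=.
case E: seq.filter => [|k s].
  have : i \in [seq j <- oB | (j \in S)
                  && (max_vbar b (~: S)%SET / gamma <= vbar b j)].
    by rewrite mem_filter iS ri (perm_mem hoB) mem_enum.
  by rewrite E.
have : k \in [seq j <- oB | (j \in S)
                && (max_vbar b (~: S)%SET / gamma <= vbar b j)].
  by rewrite E mem_head.
by rewrite mem_filter => /andP[/andP[_ /le_trans->]] //; apply: vbar_le_welfare.
Qed.

(* When the two largest values are within a factor gamma, auction B collects
   9/10 of the largest one as soon as it separates these two agents. *)
Lemma auctionB_separates S i : i != top b -> a < gamma * vbar b i ->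
  9/10 * a * ((1 - side S (top b) * side S i) / 2) <= W (auctionB gamma oB S b).
Proof.
move=> it ai; have a0 : 0 <= a := vbar_ge0 _.
have WB0 := valid_welfare_ge0 (valid_auctionB oB S (ltW gamma0)).
set g := gamma^-1; have g0 : 0 < g by rewrite invr_gt0.
have g2 : g ^+ 2 = 9/10 by rewrite /g exprVn gamma2 invf_div.
have g1 : g <= 1 by nra.
have g9 : 9/10 <= g by nra.
have gg : g * gamma = 1 by rewrite mulVf // gt_eqF.
have agi : g * a < vbar b i by rewrite ltr_pdivrMl.
have maxa : max_vbar b (~: S)%SET <= a.
  by apply/bigmax_leP; split=> // j _; apply: htop.
(* The factor with the signs is the indicator of separation. If the top agent is in [S], the price
   is at least [g * vbar b i], hence at least [g ^+ 2 * a]; if [i] is, the price is [g * a], which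
   [i] accepts. *)
rewrite /side.
have [tS|tNS] := boolP (top b \in S); have [iS|iNS] := boolP (i \in S).
- by rewrite mulr1 subrr mul0r mulr0.
- have vi : vbar b i <= max_vbar b (~: S)%SET by apply: le_max_vbar; rewrite inE.
  apply: le_trans (auctionB_welfare tS _); rewrite -/g.
    by nra.
  by nra.
- have at_ : a <= max_vbar b (~: S)%SET by apply: le_max_vbar; rewrite inE.
  apply: le_trans (auctionB_welfare iS _); rewrite -/g.
    by nra.
  by nra.
- by rewrite mulrNN mulr1 subrr mul0r mulr0.
Qed.

(** The weights 5/21 and 10/21 are mu/3 and 2 mu/3. A sale in A contributes 5/21, more than 3/14;
    otherwise B separates two agents with probability 1/2, and 10/21 * 9/20 = 3/14. *)
Lemma large_agents_welfare :
  3/14 * a <= 5/21 * W (auctionA gamma top b)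
    + 10/21 * (1/2) ^+ n * \sum_(S : {set 'I_n}) W (auctionB gamma oB S b).
Proof.
have a0 : 0 <= a := vbar_ge0 _.
have WB0 S := valid_welfare_ge0 (valid_auctionB oB S (ltW gamma0)).
have WA0 := valid_welfare_ge0 (valid_auctionA top (ltW gamma0)).
have p0 : 0 <= (1/2 : R) ^+ n by rewrite exprn_ge0 // divr_ge0.
have [hA|] := lerP (gamma * max_vbar b (~: [set top b])%SET) a.
  have : a <= W (auctionA gamma top b).
    by rewrite /auctionA /= ifT //; apply: vbar_le_welfare.
  have : 0 <= 10/21 * (1/2) ^+ n * \sum_(S : {set 'I_n}) W (auctionB gamma oB S b).
    by rewrite mulr_ge0 ?sumr_ge0 // mulr_ge0 //; lra.
  by lra.
rewrite -ltr_pdivrMl // => /bigmax_gtP[|[i it ai]].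
  (* The default value 0 of the maximum cannot exceed the nonnegative [a / gamma], so some agent
     does. *)
  by rewrite ltNge mulr_ge0 // invr_ge0 ltW.
rewrite !inE in it; rewrite ltr_pdivrMl // in ai.
have : \sum_(S : {set 'I_n}) 9/10 * a * ((1 - side S (top b) * side S i) / 2)
        <= \sum_(S : {set 'I_n}) W (auctionB gamma oB S b).
  by apply: ler_sum => S _; apply: auctionB_separates.
rewrite -mulr_sumr -mulr_suml sumrB sum_side eq_sym (negbTE it) subr0.
rewrite sumr_const_set [1 * _ ^+ _]mul1r.
move=> /(ler_wpM2l p0).
have -> : (1/2) ^+ n * (9/10 * a * (2 ^+ n / 2)) = 9/20 * a * ((1/2) ^+ n * 2 ^+ n) :> R.
  by field.
by rewrite -exprMn mul1r mulVf ?pnatr_eq0 // expr1n; lra.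
Qed.

End LargeAgents.

(** * Contribution of auction C when every agent is small *)

Section SmallAgents.
Variables (oC : seq 'I_n) (a : R).
Hypotheses (hoC : perm_eq oC (enum 'I_n)).
Hypotheses (a0 : 0 <= a) (ha : forall i, vbar b i <= a).
Hypotheses (aO : a <= 3/20 * O) (O0 : 0 < O).
Variable z : 'I_n -> R.
Hypotheses (fz : feasible [set: 'I_n] z)
  (Oz : O = liquid_welfare b [set: 'I_n] z).

Local Notation w i := (liquid (b i) (z i)).

Lemma auctionC_welfareE S :
  W (auctionC (3/10) oC S b)
  = liquid_welfare b S (serve b (price (3/10) b (~: S)%SET) (1/2)
                          [seq i <- oC | i \in S])
  + liquid_welfare b (~: S)%SET (serve b (price (3/10) b S) (1/2)
                                   [seq i <- oC | i \in (~: S)%SET]).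
Proof.
rewrite /liquid_welfare (big_setID S) /= finset.setTI finset.setTD.
congr (_ + _); apply: eq_bigr => i; first by move->.
by rewrite inE => /negbTE->.
Qed.

(** Both unit prices are at most 3/10 of the optimum, so [serve_welfare] applies to both sides with
    this common [K]. Dividing by the optimum gives the hypotheses of [two_sides_welfare], and the
    signed sum is twice the share of [S] minus the whole. *)
Lemma auctionC_welfare S :
  (3/20 * O - a) * (1 - 35/8 * (\sum_i side S i * w i) ^+ 2 / O ^+ 2)
    <= W (auctionC (3/10) oC S b).
Proof.
have sumw : \sum_i w i = O.
  by rewrite Oz /liquid_welfare; apply: eq_bigl => i; rewrite inE.
have OPT_ge_w Q : \sum_(i in Q) w i <= OPT b Q.
  by apply: OPT_ge => //; apply: feasibleS fz; apply: finset.subsetT.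
have OPT_le_O Q : OPT b Q <= O by apply: OPT_le => //; apply: finset.subsetT.
have sumwC : \sum_(i in (~: S)%SET) w i = O - \sum_(i in S) w i.
  rewrite -sumw [\sum_i w i](bigID (mem S)) /= addrC addrK.
  by apply: eq_bigl => i; rewrite inE.
have sideW Q T : let x := serve b (price (3/10) b T) (1/2)
                            [seq i <- oC | i \in Q] in
    0 <= liquid_welfare b Q x / O /\
    (OPT b Q / O - 3/10 <= liquid_welfare b Q x / O \/
     OPT b T / O * (3/20 - a / O) <= liquid_welfare b Q x / O).
  move=> x; have c0 : 0 <= price (3/10) b T by apply: price_ge0 => //; lra.
  have cK : price (3/10) b T <= 3/10 * O by rewrite ler_wpM2l //; lra.
  split.
    rewrite divr_ge0 ?(ltW O0) //; apply: liquid_welfare_ge0 => // i _.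
    have [/andP[-> x12] _] := serve_itv i badm.1 c0 half_itv (uniq_order hoC Q).
    by apply: le_trans x12 _; lra.
  have [h|h] := serve_welfare badm hoC Q c0 cK ha; [left|right].
    rewrite -[3/10](mulfK (lt0r_neq0 O0)) -mulrBl ler_pM2r ?invr_gt0 //.
  have -> : OPT b T / O * (3/20 - a / O)
      = price (3/10) b T * (3/10 * O / 2 - a) / (3/10 * O) / O.
    by rewrite /price; field; rewrite gt_eqF.
  have K0 : 0 < 3/10 * O by rewrite mulr_gt0 // divr_gt0.
  by rewrite ler_pM2r ?invr_gt0 // ler_pdivrMr // [leRHS]mulrC.
have le1 Q : OPT b Q / O <= 1 by rewrite ler_pdivrMr // mul1r.
have d01 : 0 <= 3/20 - a / O <= 3/20.
  by rewrite subr_ge0 gerBl ler_pdivrMr // aO divr_ge0 // ltW.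
have hS : (\sum_(i in S) w i) / O <= OPT b S / O <= 1.
  by rewrite le1 andbT ler_pM2r ?invr_gt0.
have hT : 1 - (\sum_(i in S) w i) / O <= OPT b (~: S)%SET / O <= 1.
  rewrite le1 andbT -[X in X - _](divff (lt0r_neq0 O0)) -mulrBl -sumwC.
  by rewrite ler_pM2r ?invr_gt0.
have [p0 pS] := sideW S (~: S)%SET.
have [q0 qT] := sideW (~: S)%SET S.
have := two_sides_welfare d01 hS hT p0 q0 pS qT.
rewrite -mulrDl ler_pdivlMr // auctionC_welfareE; apply: le_trans.
rewrite le_eqVlt sum_sideE sumw; apply/orP; left; apply/eqP.
by field; rewrite gt_eqF.
Qed.

(** Averaging over [S] turns the squared signed sum into the sum of the [w i ^+ 2], which is at most
    [a] times the sum of the [w i]. *)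
Lemma small_agents_welfare :
  (3/20 * O - a) * (1 - 35/8 * (a / O))
    <= (1/2) ^+ n * \sum_(S : {set 'I_n}) W (auctionC (3/10) oC S b).
Proof.
have sumw : \sum_i w i = O.
  by rewrite Oz /liquid_welfare; apply: eq_bigl => i; rewrite inE.
have wa i : 0 <= w i <= a.
  have /andP[z0 z1] : 0 <= z i <= 1 by apply: feasible_itv fz _; rewrite inE.
  rewrite liquid_ge0 ?z0 //=; last exact: badm.1.
  by apply: le_trans (ha i); apply: le_liquid => //; apply: badm.1.
have sqw : \sum_i w i ^+ 2 <= a * O.
  rewrite -sumw mulr_sumr; apply: ler_sum => i _; have /andP[w0 wia] := wa i.
  by rewrite expr2 ler_wpM2r.
have p0 : 0 < (1/2 : R) ^+ n by rewrite exprn_gt0 // divr_gt0.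
have p2 : (1/2 : R) ^+ n * 2 ^+ n = 1.
  by rewrite -exprMn mul1r mulVf ?pnatr_eq0 // expr1n.
have : \sum_(S : {set 'I_n})
    (3/20 * O - a) * (1 - 35/8 * (\sum_i side S i * w i) ^+ 2 / O ^+ 2)
    <= \sum_(S : {set 'I_n}) W (auctionC (3/10) oC S b).
  by apply: ler_sum => S _; apply: auctionC_welfare.
rewrite -mulr_sumr sumrB -mulr_suml -mulr_sumr sum_side_sqr.
rewrite sumr_const_set [1 * _ ^+ _]mul1r.
move=> /(ler_wpM2l (ltW p0)); apply: le_trans.
have -> : (1/2) ^+ n * ((3/20 * O - a) *
    (2 ^+ n - 35/8 * (2 ^+ n * \sum_i w i ^+ 2) / O ^+ 2))
  = (1/2 : R) ^+ n * 2 ^+ n *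
    ((3/20 * O - a) * (1 - 35/8 * ((\sum_i w i ^+ 2) / O / O))).
  by field; rewrite gt_eqF.
rewrite p2 mul1r ler_wpM2l ?subr_ge0 // lerD2l lerN2.
rewrite ler_wpM2l ?divr_ge0 //.
by rewrite ler_pM2r ?invr_gt0 // ler_pdivrMr.
Qed.

End SmallAgents.

End RandomSampling.

(** * The distribution of the seed and the final estimate *)

Lemma sum_rs_seed (R : realType) (n : nat) (F : rs_seed (n := n) -> R) :
  \sum_w F w = F (inl tt)
    + (\sum_(S : {set 'I_n}) F (inr (inl S))
       + \sum_(S : {set 'I_n}) F (inr (inr S))).
Proof.
by rewrite /rs_seed !big_sumType /= (big_pred1 tt) // => -[].
Qed.

Lemma sum_rs_prob (R : realType) (n : nat) (mu : R) :
  \sum_(w : rs_seed (n := n)) rs_prob mu w = 1.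
Proof.
rewrite sum_rs_seed /= !sumr_const_set.
have p2 : (1/2 : R) ^+ n * 2 ^+ n = 1.
  by rewrite -exprMn mul1r mulVf ?pnatr_eq0 // expr1n.
by rewrite -![_ * _ ^+ n * _]mulrA p2; field.
Qed.

Theorem theorem3p1 (R : realType) (n : nat)
    (top : profile R n -> 'I_n) (oB oC : seq 'I_n)
    (htop : forall b i, vbar b i <= vbar b (top b))
    (hoB : perm_eq oB (enum 'I_n)) (hoC : perm_eq oC (enum 'I_n)) :
  let M := random_sampling_auction (3/10) (Num.sqrt (10/9)) (5/7) top oB oC in
  [/\ universally_truthful M,
      budget_feasible M
    & forall b : profile R n, admissible b ->
        1/34 * OPT b [set: 'I_n] <= expected_liquid_welfare M b].
Proof.
set gamma := Num.sqrt _.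
have gamma2 : gamma ^+ 2 = 10/9 by rewrite sqr_sqrtr // divr_ge0.
have gamma1 : 1 < gamma.
  by rewrite -[ltLHS]sqrtr1 ltr_sqrt ?divr_gt0 //; lra.
have gamma0 : 0 < gamma := lt_trans ltr01 gamma1.
have beta0 : 0 <= 3/10 :> R by rewrite divr_ge0.
move=> M; split.
- split=> [w||].
  + have p0 : 0 <= (1/2 : R) ^+ n by rewrite exprn_ge0 // divr_ge0.
    by case: w => [_|[S|S]] /=; rewrite ?mulr_ge0 //; lra.
  + exact: sum_rs_prob.
  + case=> [_|[S|S]] /=; split.
    * exact/valid_auctionA/ltW.
    * exact: truthful_auctionA.
    * exact/valid_auctionB/ltW.
    * exact: truthful_auctionB.
    * exact: valid_auctionC.
    * exact: truthful_auctionC.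
- case=> [[]|[S|S]] b i badm.
  + exact: budget_auctionA.
  + exact: budget_auctionB.
  + by have [_ /andP[]] := auctionC_itv hoC S i beta0 badm.
- move=> b badm.
  have := sum_rs_seed (fun w => rs_prob (5/7) w *
    liquid_welfare b [set: 'I_n]
      (alloc (rs_run (3/10) gamma top oB oC w b))).
  rewrite /expected_liquid_welfare => -> /=; rewrite -!mulr_sumr.
  have := large_agents_welfare badm htop hoB gamma0 gamma2.
  have := small_agents_welfare badm hoC (vbar_ge0 badm (top b)) (htop b).
  have := vbar_ge0 badm (top b).
  set a := vbar b (top b); set O := OPT b _ => a0 small.
  set WA := liquid_welfare _ _ _; set WB := \sum_S _; set WC := \sum_S _.
  move=> large; have p0 : 0 < (1/2 : R) ^+ n by rewrite exprn_gt0 // divr_gt0.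
  have WC0 : 0 <= (1/2) ^+ n * WC.
    rewrite mulr_ge0 ?(ltW p0) //; apply: sumr_ge0 => S _.
    exact: (valid_welfare_ge0 badm (valid_auctionC hoC S beta0)).
  (* The weight of auction C is 1 - mu = 2/7. When [a] exceeds [3/20 * O], A and B suffice: 3/14 *
     3/20 = 9/280 is above 1/34. *)
  suff : 1/34 * O <= 3/14 * a + 2/7 * ((1/2) ^+ n * WC) by lra.
  have [a1|a1] := lerP a (3/20 * O); last by lra.
  have [O0|O0] := lerP O 0; first by lra.
  have [z fz Oz] := OPT_eq [set: 'I_n] badm.
  have {}small := small a1 O0 z fz Oz.
  suff : 1/34 * O <= 3/14 * a + 2/7 * ((3/20 * O - a) * (1 - 35/8 * (a / O))).
    by move: small; rewrite -/WC; lra.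
  rewrite -(mulfVK (lt0r_neq0 O0) a) mulfK ?lt0r_neq0 //.
  set x := a / O; rewrite -subr_ge0.
  have -> : 3/14 * (x * O) + 2/7 * ((3/20 * O - x * O) * (1 - 35/8 * x))
      - 1/34 * O = O * (5/4 * x ^+ 2 - 29/112 * x + 8/595).
    by field.
  rewrite mulr_ge0 ?(ltW O0) //.
  (* The quadratic is minimal at 29/280, where its value 8/595 - 841/62720 is barely positive. *)
  have := sqr_ge0 (x - 29/280); lra.
Qed.
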